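(* Let $\mu$ be a probability measure on $\mathbb{R}$ whose support is not included in $(-\infty,0)$, and write $\mu_n=\mu(\{n\})$ for integers $n\ge0$. Assume $(\mu_n)_{n\ge0}$ is completely monotone, so that $\mu_n=\int_0^1t^n\,\nu(dt)$, $n\ge0$, for a unique finite measure $\nu$ on $[0,1]$, and assume the support of $\nu$ contains a decreasing sequence $(c_n)$ with $\sum_n(-\ln c_n)^{-1}=\infty$. Then the restrictions of $\mu$ and $\mu*\mu$ to $[0,\infty)$ determine whether the support of $\mu$ is included in $\mathbb{Z}$. If the support of $\mu$ is included in $\mathbb{Z}$, then $\mu$ is determined by the restrictions of $\mu$ and $\mu*\mu$ to $[0,\infty)$ (any probability measure $\mu_1$ on $\mathbb{R}$ with $\mu_1=\mu$ and $\mu_1*\mu_1=\mu*\mu$ on $[0,\infty)$ equals $\mu$); in particular $\mu\in\mathscr{C}$.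
   Context: A sequence $(a_k)_{k\ge0}$ of nonnegative reals is completely monotone if $\Delta^na_k\ge0$ for all $k\ge0$, $n\ge1$, where $\Delta^0a=a$ and $\Delta^na_k=\Delta^{n-1}a_k-\Delta^{n-1}a_{k+1}$. $\mathscr{C}$ is the set of probability measures $\mu$ on $\mathbb{R}$ such that every probability measure $\mu_1$ with $\mu_1^{*n}=\mu^{*n}$ on $[0,\infty)$ for all $n\ge1$ ($*n$ = $n$-fold convolution power) equals $\mu$. *)

(* Defs.v *)
From HB Require Import structures.
From mathcomp Require Import all_boot all_order all_algebra.
From mathcomp Require Import all_classical all_reals all_analysis.
Set Implicit Arguments. Unset Strict Implicit. Unset Printing Implicit Defensive.
Import Order.TTheory GRing.Theory Num.Theory.
Import numFieldNormedType.Exports.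
Local Open Scope classical_set_scope.
Local Open Scope ring_scope.

Fixpoint Delta {R : realType} (n : nat) (a : nat -> R) : nat -> R :=
  match n with
  | 0 => a
  | m.+1 => fun k => Delta m a k - Delta m a k.+1
  end.

Definition completely_monotone {R : realType} (a : nat -> R) : Prop :=
  (forall k, 0 <= a k) /\ (forall n k, (1 <= n)%N -> 0 <= Delta n a k).

Definition msupport {R : realType} (mu : set R -> \bar R) : set R :=
  [set x | forall e : R, 0 < e -> (0 < mu (ball x e))%E].

Definition Zset {R : realType} : set R := [set x | exists z : int, x = z%:~R].

Definition nonneg_half {R : realType} : set R := [set x | 0 <= x].

Definition shiftset {R : realType} (A : set R) (y : R) : set R :=
  [set x | A (x + y)].

Fixpoint convpow {R : realType} (mu : probability R R) (n : nat)
  : set R -> \bar R :=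
  match n with
  | 0 => fun A => \d_(0 : R) A
  | m.+1 => fun A => (\int[mu]_y convpow mu m (shiftset A y))%E
  end.

Definition eq_on_nonneg {R : realType} (m1 m2 : set R -> \bar R) : Prop :=
  forall A : set R, measurable A -> A `<=` nonneg_half -> m1 A = m2 A.

Definition inC {R : realType} (mu : probability R R) : Prop :=
  forall mu1 : probability R R,
    (forall n, (1 <= n)%N -> eq_on_nonneg (convpow mu1 n) (convpow mu n)) ->
    forall A : set R, measurable A -> mu1 A = mu A.

Definition unit_itv {R : realType} : set R := [set x | 0 <= x <= 1].

(* Main.v *)
(* Write [sigma] for the difference of [mu] and [mu1]; it lives on the negative
   half-line, and on [0, oo) the two convolution squares differ by
   [2 mu^+ * sigma].  All [mu {n}] are positive, so if [mu] lives on [Z] then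
   [mu1] has no mass off [Z].  With [b_k = sigma {- k}] the equality of the
   squares at [n] becomes [sum_k b_k mu_(n + k) = 0], that is, [B(t) =
   sum_k b_k t^k] is orthogonal to every polynomial in [L^2(nu)].  Testing
   against the polynomials [(1 - (t - c)^2)^j], which peak at [c], shows that
   [B] vanishes on the support of [nu], in particular at all [c_n].  These stay
   below [c_0 < 1], so comparing with the finite Blaschke products with zeros
   [c_0, ..., c_(n-1)] bounds the lowest coefficient of [B] by a multiple of
   [c_0 ... c_(n-1) -> 0], and hence [B = 0]. *)
Require Import Defs.
From HB Require Import structures.
From mathcomp Require Import all_boot all_order all_algebra.
From mathcomp Require Import all_classical all_reals all_analysis.
From mathcomp Require Import measurable_realfun ring lra zify.
Import Order.TTheory GRing.Theory Num.Theory.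
Import numFieldNormedType.Exports.
Local Open Scope classical_set_scope.
Local Open Scope ring_scope.

Set Implicit Arguments.
Unset Strict Implicit.

(** * Finite Blaschke products and power series with prescribed zeros *)

(* Multiplication of the power series [sum beta_k t^k] by [(t - x) / (1 - x t)];
   [blaschke_quot x beta] is the shifted series [t beta(t) / (1 - x t)]. *)
Fixpoint blaschke_quot {R : realType} (x : R) (beta : nat -> R) (k : nat) : R :=
  if k is k'.+1 then x * blaschke_quot x beta k' + beta k' else 0.

Definition blaschke_mul {R : realType} (x : R) (beta : nat -> R) (k : nat) : R :=
  blaschke_quot x beta k - x * blaschke_quot x beta k.+1.

(** With [q] the quotient series, [beta k = q (k+1) - x q k], and the difference of the two squares
    at [k] is [(1 - x^2) (q (k+1)^2 - q k^2)], which telescopes. This is the isometry property of a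
    Blaschke factor, with the exact truncation defect. *)
Lemma blaschke_mul_norm (R : realType) (x : R) (beta : nat -> R) (N : nat) :
  \sum_(k < N) blaschke_mul x beta k ^+ 2 =
  \sum_(k < N) beta k ^+ 2 - (1 - x ^+ 2) * blaschke_quot x beta N ^+ 2.
Proof.
elim: N => [|N IH]; first by rewrite !big_ord0 /= expr0n mulr0 subrr.
by rewrite !big_ord_recr /= IH /blaschke_mul /=; ring.
Qed.

(** Partial fractions: [beta] has generating function [K + sum_i lam_i / (1 - c_i t)], and
    [t / ((1 - x t) (1 - c t))] is [1 / (1 - x t) - 1 / (1 - c t)] divided by [x - c]. *)
Lemma blaschke_quot_span (R : realType) (n : nat) (c lam : nat -> R)
    (beta : nat -> R) (K x : R) :
  x != 0 -> (forall i, (i < n)%N -> x - c i != 0) ->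
  (forall k, beta k = K * (k == 0)%:R + \sum_(i < n) lam i * c i ^+ k) ->
  forall k, blaschke_quot x beta k =
    K * (x ^+ k - (k == 0)%:R) / x
    + \sum_(i < n) lam i * (x ^+ k - c i ^+ k) / (x - c i).
Proof.
move=> x0 xc betaE; elim=> [|k IH] /=.
  rewrite subrr mulr0 mul0r add0r big1// => i _.
  by rewrite mulr0 mul0r.
rewrite IH betaE mulrDr addrACA; congr (_ + _).
  by rewrite exprS; field.
rewrite mulr_sumr -big_split /=; apply: eq_bigr => i _.
by rewrite !exprS; field; exact: xc.
Qed.

(** The only new pole is a simple one at [1 / c n]. [K] is the value of the generating function at
    infinity, where the Blaschke factor equals [- 1 / c n]. *)
Lemma blaschke_mul_span (R : realType) (n : nat) (c lam : nat -> R)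
    (beta : nat -> R) (K : R) :
  c n != 0 -> (forall i, (i < n)%N -> c n - c i != 0) ->
  (forall k, beta k = K * (k == 0)%:R + \sum_(i < n) lam i * c i ^+ k) ->
  exists lam' : nat -> R, forall k,
    blaschke_mul (c n) beta k =
    - (K / c n) * (k == 0)%:R + \sum_(i < n.+1) lam' i * c i ^+ k.
Proof.
move=> cn0 cnc betaE; set x := c n.
(* At an old pole [1 / c i] the coefficient is multiplied by the value of the factor there; at the
   new pole [1 / x] it is [(1 / x - x) beta(1 / x)]. *)
exists (fun i => if i == n
  then K / x - x * K + \sum_(j < n) lam j * (1 - x ^+ 2) / (x - c j)
  else lam i * (x * c i - 1) / (x - c i)) => k.
rewrite /blaschke_mul !(@blaschke_quot_span _ n c lam beta K)//.
rewrite big_ord_recr /= eqxx.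
under [in RHS]eq_bigr => i _ do rewrite (ltn_eqF (ltn_ord i)).
set S1 := \sum_(i < n) _ / _; set S2 := \sum_(i < n) _ / _.
set S3 := \sum_(i < n) _; set S4 := \sum_(j < n) _.
have S12 : S1 - x * S2 = S3 + S4 * x ^+ k.
  rewrite /S3 mulr_sumr mulr_suml -sumrN -!big_split /=.
  by apply: eq_bigr => i _; rewrite !exprS; field; exact: cnc.
transitivity (K * (x ^+ k - (k == 0)%:R) / x - x * (K * x ^+ k.+1 / x)
    + (S1 - x * S2)); first by rewrite subr0; ring.
rewrite S12 exprS; field.
exact: cn0.
Qed.

(** [beta] is the coefficient sequence of the Blaschke product with zeros [c 0, ..., c (n-1)]. In
    this form, pairing it with a power series evaluates that series at [0] and at the [c i], with
    weight [prod (- 1 / c i)] at [0]. *)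
Lemma blaschke_span (R : realType) (c : nat -> R) (n : nat) :
  (forall i, 0 < c i < 1) -> (forall i, c i.+1 < c i) ->
  exists beta lam : nat -> R,
    [/\ forall k, beta k = \prod_(i < n) (- (c i)^-1) * (k == 0)%:R
                           + \sum_(i < n) lam i * c i ^+ k
      & forall N, \sum_(k < N) beta k ^+ 2 <= 1].
Proof.
move=> c01 cdec; elim: n => [|n [beta [lam [betaE betaN]]]].
  exists (fun k => (k == 0)%:R), (fun=> 0); split=> [k|[|N]].
  - by rewrite !big_ord0 mul1r addr0.
  - by rewrite big_ord0.
  - by rewrite big_ord_recl/= big1 ?expr1n ?addr0// => i _; rewrite expr0n.
have /andP[cn0 cn1] := c01 n.
have cnc i : (i < n)%N -> c n - c i != 0.
  move=> ltin; rewrite subr_eq0 lt_eqF//.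
  have gt_trans : transitive (fun a b : R => b < a).
    by move=> a b d ab da; exact: lt_trans da ab.
  exact: (homo_ltn gt_trans cdec ltin).
have [lam' mulE] := blaschke_mul_span (lt0r_neq0 cn0) cnc betaE.
exists (blaschke_mul (c n) beta), lam'; split=> [k|N].
  by rewrite mulE [\prod_(_ < _.+1) _]big_ord_recr /= mulrN.
rewrite blaschke_mul_norm (le_trans _ (betaN N))// lerBlDr lerDl.
by rewrite mulr_ge0 ?sqr_ge0// subr_ge0 expr_le1// ltW.
Qed.

Lemma le_geometric_le0 (R : realType) (a z x : R) :
  0 <= z < 1 -> (forall n : nat, x <= a * z ^+ n) -> x <= 0.
Proof.
move=> /andP[z0 z1] xaz.
have lim : geometric a z n @[n --> \oo] --> 0.
  by apply: cvg_geometric; rewrite ger0_norm.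
rewrite -(cvg_lim _ lim)//; apply: limr_ge; last exact: nearW.
by apply/cvg_ex; eexists; exact: lim.
Qed.

Lemma cvg_lin_comb (R : realType) (n : nat) (lam : nat -> R)
    (u : nat -> nat -> R) :
  (forall i, u i N @[N --> \oo] --> 0) ->
  \sum_(i < n) lam i * u i N @[N --> \oo] --> 0.
Proof.
move=> u0; elim: n => [|n IH].
  have -> : (fun N => \sum_(i < 0) lam i * u i N) = cst 0.
    by apply/funext => N; rewrite big_ord0.
  exact: cvg_cst.
have -> : (fun N => \sum_(i < n.+1) lam i * u i N) =
    (fun N => \sum_(i < n) lam i * u i N + lam n * u n N).
  by apply/funext => N; rewrite big_ord_recr.
have := cvgD IH (@cvgMl_tmp _ _ _ _ _ (lam n) _ (u0 n)).
by rewrite mulr0 addr0; exact.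
Qed.

(** Pair [b] with the Blaschke coefficients [beta]. The geometric parts of [beta] contribute
    multiples of the values [sum_k b_k c_i^k = 0], so the pairing equals [K b_0]; since
    [|beta k| <= 1], it is at most [M] in absolute value. As [|K|] is at least [c_0^(-n)], letting
    [n] grow forces [b_0 = 0]. *)
Lemma pseries_zeros_coef0 (R : realType) (c b : nat -> R) (M : R) :
  (forall i, 0 < c i < 1) -> (forall i, c i.+1 < c i) ->
  (forall N, \sum_(k < N) `|b k| <= M) ->
  (forall i, \sum_(k < N) b k * c i ^+ k @[N --> \oo] --> 0) ->
  b 0 = 0.
Proof.
move=> c01 cdec bM bc0; apply/eqP/negP => /negP b0.
have bnd n : (c 0)^-1 ^+ n * `|b 0| <= M.
  have [beta [lam [betaE betaN]]] := blaschke_span n c01 cdec.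
  set K := \prod_(i < n) _ in betaE.
  have KE : (c 0)^-1 ^+ n <= `|K|.
    rewrite normr_prod -[X in _ ^+ X]card_ord -prodr_const ler_prod// => i _.
    have /andP[ci0 _] := c01 i; have /andP[c00 _] := c01 0.
    rewrite normrN gtr0_norm ?invr_gt0// invr_ge0 ltW//=.
    rewrite lef_pV2//.
    have cmono : nonincreasing_seq c.
      by apply/nonincreasing_seqP => m; exact: ltW.
    exact: cmono.
  (* An empty sum would miss the index [0], which carries [K]. *)
  have splitE N : (0 < N)%N ->
      K * b 0 + \sum_(i < n) lam i * (\sum_(k < N) b k * c i ^+ k) =
      \sum_(k < N) b k * beta k.
    move=> N0; under [in RHS]eq_bigr => k _ do rewrite betaE mulrDr.
    rewrite big_split /=; congr (_ + _).
      case: N N0 => // N _; rewrite big_ord_recl /= big1 ?addr0 ?mulr1 1?mulrC//.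
      by move=> i _; rewrite mul0r mulr0.
    under eq_bigr => i _ do rewrite mulr_sumr.
    rewrite exchange_big /=; apply: eq_bigr => k _.
    by rewrite mulr_sumr; apply: eq_bigr => i _; rewrite mulrCA.
  have lim : \sum_(k < N) b k * beta k @[N --> \oo] --> K * b 0.
    rewrite -[K * b 0]addr0.
    have : (K * b 0) + \sum_(i < n) lam i * (\sum_(k < N) b k * c i ^+ k)
        @[N --> \oo] --> K * b 0 + 0.
      apply: cvgD; first exact: cvg_cst.
      exact: (@cvg_lin_comb R n lam (fun i N => \sum_(k < N) b k * c i ^+ k)).
    apply: cvg_trans; apply: near_eq_cvg.
    by apply: filterS (nbhs_infty_gt 0) => N N0; exact: splitE.
  have beta1 k : `|beta k| <= 1.
    rewrite -(@expr_le1 _ 2)// -normrX ger0_norm ?sqr_ge0//.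
    rewrite (le_trans _ (betaN k.+1))// big_ord_recr /= lerDr.
    by rewrite sumr_ge0// => i _; exact: sqr_ge0.
  apply: (@le_trans _ _ `|K * b 0|); first by rewrite normrM ler_wpM2r.
  have limn : `|\sum_(k < N) b k * beta k| @[N --> \oo] --> `|K * b 0|.
    exact: cvg_norm lim.
  rewrite -(cvg_lim _ limn)//; apply: limr_le.
    by apply/cvg_ex; eexists; exact: limn.
  apply: nearW => N; rewrite (le_trans _ (bM N))//.
  rewrite (le_trans (ler_norm_sum _ _ _))//.
  by apply: ler_sum => k _; rewrite normrM ler_piMr.
have /andP[c00 c01'] := c01 0.
have M0 : 0 <= M by have := bM 0%N; rewrite big_ord0.
have : `|b 0| <= 0.
  apply: (@le_geometric_le0 _ M (c 0)); first by rewrite ltW.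
  by move=> n; rewrite -ler_pdivrMr ?exprn_gt0// -exprVn mulrC.
by rewrite normr_le0 (negbTE b0).
Qed.

(** Once the coefficients below [m] vanish, dividing by [t^m] keeps the zeros [c i > 0] and the
    bound [M], and makes [b m] the constant term. *)
Lemma pseries_zeros_coef (R : realType) (c b : nat -> R) (M : R) :
  (forall i, 0 < c i < 1) -> (forall i, c i.+1 < c i) ->
  (forall N, \sum_(k < N) `|b k| <= M) ->
  (forall i, \sum_(k < N) b k * c i ^+ k @[N --> \oo] --> 0) ->
  forall m, b m = 0.
Proof.
move=> c01 cdec bM bc0 m; elim/ltn_ind: m => m IH.
have splitm (F : nat -> R) N :
    \sum_(k < N + m) F k = \sum_(k < m) F k + \sum_(k < N) F (k + m)%N.
  rewrite -!(big_mkord xpredT) (@big_cat_nat _ _ _ m) ?leq_addl//=; congr (_ + _).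
  by rewrite -[X in \sum_(X <= _ < _ + _) _]add0n big_addn addnK big_mkord.
apply: (@pseries_zeros_coef0 _ c (fun k => b (k + m)%N) M) => // [N|i].
  by rewrite (le_trans _ (bM (N + m)%N))// (splitm (fun k => `|b k|)) lerDr sumr_ge0.
have /andP[ci0 _] := c01 i.
have -> : (fun N => \sum_(k < N) b (k + m)%N * c i ^+ k) =
    (fun N => (c i ^+ m)^-1 * \sum_(k < N + m) b k * c i ^+ k).
  apply/funext => N; rewrite (splitm (fun k => b k * c i ^+ k)).
  rewrite [X in X + _]big1 ?add0r; last first.
    by move=> k _; rewrite (IH _ (ltn_ord k)) mul0r.
  rewrite mulr_sumr; apply: eq_bigr => k _; rewrite exprD.
  by field; rewrite expf_neq0// gt_eqF.
have := bc0 i; rewrite -(cvg_shiftn m) => bc0m.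
have := @cvgMl_tmp _ _ _ _ _ (c i ^+ m)^-1 _ bc0m.
by rewrite mulr0; exact.
Qed.

(** * Integration of polynomials over the unit interval *)

Lemma unit_itvE (R : realType) : @unit_itv R = `[0, 1]%classic.
Proof. by apply/seteqP; split=> x; rewrite /= in_itv. Qed.

Lemma measurable_unit_itv (R : realType) : measurable (@unit_itv R).
Proof. by rewrite unit_itvE; exact: measurable_itv. Qed.
#[local] Hint Extern 0 (measurable unit_itv) =>
  solve [exact: measurable_unit_itv] : core.

Lemma unit_itv_horner_bounded (R : realType) (p : {poly R}) :
  exists2 M, 0 <= M & forall t, unit_itv t -> `|p.[t]| <= M.
Proof.
have : compact (horner p @` unit_itv).
  apply: continuous_compact; last by rewrite unit_itvE; exact: segment_compact.
  by apply: continuous_subspaceT => x; exact: continuous_horner.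
move=> /compact_bounded[M [_ Mp]]; exists (`|M| + 1); first by rewrite addr_ge0.
move=> t tu; apply: (Mp (`|M| + 1)); last by exists t.
by rewrite (le_lt_trans (ler_norm M))// ltrDl.
Qed.

Lemma integrable_horner (R : realType) (nu : {finite_measure set R -> \bar R})
  (p : {poly R}) : nu.-integrable unit_itv (EFin \o horner p).
Proof.
apply: measurable_bounded_integrable => //.
- by rewrite ltey_eq fin_num_measure.
- exact: measurable_poly.
- have [M _ pM] := unit_itv_horner_bounded p.
  exists M; split=> [|x Mx t tu]; first exact: num_real.
  exact: le_trans (pM t tu) (ltW Mx).
Qed.

Definition poly_int {R : realType} (nu : {finite_measure set R -> \bar R})
  (p : {poly R}) : R := \int[nu]_(t in unit_itv) p.[t].

Section poly_int.
Variables (R : realType) (nu : {finite_measure set R -> \bar R}).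
Local Notation L := (poly_int nu).

Lemma poly_intD p q : L (p + q) = L p + L q.
Proof.
rewrite -RintegralD//; try exact: integrable_horner.
by apply: eq_Rintegral => t _; rewrite hornerD.
Qed.

Lemma poly_intZ a p : L (a *: p) = a * L p.
Proof.
rewrite -RintegralZl//; try exact: integrable_horner.
by apply: eq_Rintegral => t _; rewrite hornerZ.
Qed.

Lemma poly_int_sum n (F : nat -> {poly R}) :
  L (\sum_(i < n) F i) = \sum_(i < n) L (F i).
Proof.
elim: n => [|n IH]; last by rewrite !big_ord_recr /= poly_intD IH.
by rewrite !big_ord0 -(scale0r 0) poly_intZ mul0r.
Qed.

Lemma le_poly_int p q :
  (forall t, unit_itv t -> p.[t] <= q.[t]) -> L p <= L q.
Proof. by move=> pq; apply: le_Rintegral => //; exact: integrable_horner. Qed.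

(** Integrates a step function lying below [p]. The case [b = 0] gives positivity of moments, the
    general case the concentration estimate at a support point. *)
Lemma poly_int_ball_ge p (c r a b : R) :
  ball c r `<=` unit_itv ->
  (forall t, unit_itv t -> a * \1_(ball c r) t - b <= p.[t]) ->
  a * fine (nu (ball c r)) - b * fine (nu unit_itv) <= L p.
Proof.
move=> Bu abp.
have mB : measurable (ball c r) by exact: measurable_ball.
have iB : nu.-integrable unit_itv (EFin \o \1_(ball c r)).
  apply: integrableS (integrable_indic nu mB) => //; exact: measurableT.
have ia : nu.-integrable unit_itv (EFin \o (fun t => a * \1_(ball c r) t)).
  by have := integrableZl (@measurable_unit_itv R) a iB; exact: eq_integrable.
have ib : nu.-integrable unit_itv (EFin \o cst b).
  exact: finite_measure_integrable_cst.
have -> : a * fine (nu (ball c r)) - b * fine (nu unit_itv) =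
    \int[nu]_(t in unit_itv) (a * \1_(ball c r) t - cst b t).
  rewrite RintegralB// RintegralZl// Rintegral_cst// /Rintegral integral_indic//.
  by rewrite setIidl.
apply: le_Rintegral => //; last exact: integrable_horner.
by have := integrableB (@measurable_unit_itv R) ia ib; exact: eq_integrable.
Qed.

End poly_int.

(** * Localization at a point of the support *)

(* The nonnegative polynomials [(1 - (t - c)^2)^j] concentrate at [c]. *)
Definition peak {R : realType} (c : R) (j : nat) : {poly R} :=
  (1 - ('X - c%:P) ^+ 2) ^+ j.

Lemma peak_horner (R : realType) (c : R) j t :
  (peak c j).[t] = (1 - (t - c) ^+ 2) ^+ j.
Proof. by rewrite /peak horner_exp !hornerE. Qed.

Lemma peak_ge0 (R : realType) (c : R) j t : 0 <= c <= 1 -> unit_itv t ->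
  0 <= (peak c j).[t].
Proof.
move=> /andP[c0 c1] /andP[t0 t1].
by rewrite peak_horner exprn_ge0//; nra.
Qed.

(** If [f.[c] > tau], then [g = f - tau] is at least some [eps > 0] near [c]. The inner ball
    contributes at least [eps s^j B] to the integral of [g * peak c j], the region away from [c] at
    least [- M z^j U], and [z < s], so the integral is positive for large [j]. *)
Lemma peak_support_le (R : realType) (nu : {finite_measure set R -> \bar R})
    (c tau : R) (f : {poly R}) :
  0 < c < 1 -> msupport nu c ->
  (forall j, poly_int nu (f * peak c j) <= tau * poly_int nu (peak c j)) ->
  f.[c] <= tau.
Proof.
move=> c01 cnu Lf; rewrite leNgt; apply/negP => tauf.
have /andP[c0 c1] := c01.
pose g := f - tau%:P.
have Lg j : poly_int nu (g * peak c j) <= 0.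
  by rewrite mulrDl poly_intD -polyCN mul_polyC poly_intZ mulNr subr_le0.
have [eps eps0 epsE] : exists2 eps, 0 < eps & g.[c] = 2 * eps.
  exists (g.[c] / 2); last by field.
  by rewrite divr_gt0// !hornerE subr_gt0.
have eps0' := ltW eps0.
have [d d0 gd] : exists2 d, 0 < d & forall t, `|t - c| < d -> eps <= g.[t].
  have /cvgrPdist_lt/(_ _ eps0)[d d0 gd] := @continuous_horner _ g c.
  exists d => // t; rewrite distrC => /gd /=.
  by rewrite ltr_distlC => /andP[]; rewrite epsE; lra.
(* The bounds by [c] and [1 - c] keep the ball in the unit interval and give [r <= 1/2], hence
   [z >= 0] below. *)
pose r := Num.min d (Num.min c (1 - c)).
have r0 : 0 < r by rewrite !lt_min d0 c0 subr_gt0.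
have rd : r <= d by rewrite ge_min lexx.
have rc : r <= c by rewrite !ge_min lexx orbT.
have rc1 : r <= 1 - c by rewrite !ge_min lexx !orbT.
have [M M0 gM] := unit_itv_horner_bounded g.
have Bu : ball c (r / 2) `<=` unit_itv.
  by move=> t; rewrite /ball /= ltr_distlC => /andP[? ?]; apply/andP; split; lra.
set B := fine (nu (ball c (r / 2))); set U := fine (nu unit_itv).
have B0 : 0 < B.
  rewrite fine_gt0// cnu ?divr_gt0//= ltey_eq fin_num_measure//.
  exact: measurable_ball.
have U0 : 0 <= U by rewrite fine_ge0.
(* [s] bounds [1 - (t - c)^2] from below on the ball of radius [r / 2], [z] from above outside the
   ball of radius [r]; two radii are taken to get a strict gap. *)
pose s := 1 - (r / 2) ^+ 2; pose z := 1 - r ^+ 2.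
have r1 : r <= 2^-1 by lra.
have z0 : 0 <= z by rewrite /z; nra.
have s0 : 0 < s by rewrite /s; nra.
have s0' := ltW s0.
have zs : z < s by rewrite /z /s; nra.
(* Three regions: the inner ball; the annulus up to radius [r], where [g] is still positive and the
   step function is at most [0]; and the rest, where [g >= - M]. *)
have key j : eps * s ^+ j * B - M * z ^+ j * U <= 0.
  apply: le_trans (Lg j); apply: poly_int_ball_ge => // t tu.
  rewrite hornerM; have /andP[t0 t1] := tu.
  have pk0 : 0 <= (peak c j).[t] by apply: peak_ge0 => //; rewrite !ltW.
  have tc0 : 0 <= 1 - (t - c) ^+ 2 by nra.
  have zj0 : 0 <= z ^+ j by rewrite exprn_ge0.
  have sj0 : 0 <= s ^+ j by rewrite exprn_ge0// ltW.
  have [tr|tr] := ltP `|t - c| r.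
    have := gd t (lt_le_trans tr rd) => egt.
    apply: (@le_trans _ _ (eps * (peak c j).[t])); last by rewrite ler_wpM2r.
    rewrite indicE; case: (boolP (t \in _)) => [|_] /=; last first.
      by rewrite mulr0 sub0r (@le_trans _ _ 0) ?oppr_le0 ?mulr_ge0.
    rewrite inE /ball /= distrC mulr1 => tr2.
    apply: (@le_trans _ _ (eps * s ^+ j)); first by rewrite gerBl mulr_ge0.
    rewrite ler_pM2l// peak_horner lerXn2r ?nnegrE//.
    rewrite /s lerD2l lerN2 -real_normK ?num_real//.
    by rewrite ler_sqr ?nnegrE// ?divr_ge0//; exact: ltW.
  have -> : \1_(ball c (r / 2)) t = 0 :> R.
    rewrite indicE memNset//= /ball /= distrC ltNge (le_trans _ tr)//; lra.
  rewrite mulr0 sub0r; apply: (@le_trans _ _ (- M * (peak c j).[t])).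
    rewrite mulNr lerN2 ler_wpM2l// peak_horner lerXn2r ?nnegrE//.
    rewrite /z lerD2l lerN2 -[leRHS]real_normK ?num_real// ler_sqr ?nnegrE//.
    exact: ltW.
  rewrite ler_wpM2r//.
  by have := gM t tu; rewrite ler_norml => /andP[].
suff : eps * B <= 0 by rewrite leNgt mulr_gt0.
apply: (@le_geometric_le0 _ (M * U) (z / s)).
  by rewrite divr_ge0//= ltr_pdivrMr ?mul1r.
move=> j; rewrite expr_div_n mulrA ler_pdivlMr ?exprn_gt0//.
have := key j; lra.
Qed.

(** * From vanishing moment series to zeros on the support *)

Section moment_series.
Variables (R : realType) (nu : {finite_measure set R -> \bar R}) (b : nat -> R).
Local Notation L := (poly_int nu).
Hypothesis moment_cvg0 :
  forall n, \sum_(k < N) b k * L 'X^(n + k.+1) @[N --> \oo] --> 0.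

Let f N : {poly R} := \sum_(k < N) b k *: 'X^(k.+1).

(** Orthogonality to monomials extends to all polynomials by linearity. It is stated as a limit
    because only the partial sums [f N] are polynomials. *)
Lemma poly_int_partial_cvg0 (q : {poly R}) : L (f N * q) @[N --> \oo] --> 0.
Proof.
have -> : (fun N => L (f N * q)) = (fun N => \sum_(i < size q)
    q`_i * \sum_(k < N) b k * L 'X^(i + k.+1)).
  apply/funext => N; rewrite -{1}[q]coefK poly_def mulr_sumr.
  rewrite (poly_int_sum _ _ (fun i => f N * (q`_i *: 'X^i))).
  apply: eq_bigr => i _; rewrite -scalerAr poly_intZ mulr_suml.
  rewrite (poly_int_sum _ _ (fun k => b k *: 'X^(k.+1) * 'X^i)); congr (_ * _).
  by apply: eq_bigr => k _; rewrite -scalerAl poly_intZ -exprD addnC.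
exact: (@cvg_lin_comb _ _ (nth 0 q)
  (fun i N => \sum_(k < N) b k * L 'X^(i + k.+1))).
Qed.

(** In the limit, the integral of [f N * q] is minus that of the tail times [q]. Since
    [0 <= t^(k+1) <= 1] and [q >= 0], it is at most the tail of [sum |b k|] times the integral of
    [q], and localization at [c] applies with this tail as [tau]. *)
Lemma moment_partial_le (c S : R) : 0 < c < 1 -> msupport nu c ->
  \sum_(k < N) `|b k| @[N --> \oo] --> S ->
  forall N, \sum_(k < N) b k * c ^+ k.+1 <= S - \sum_(k < N) `|b k|.
Proof.
move=> c01 cnu bS N; set s := fun N => \sum_(k < N) `|b k|.
have -> : \sum_(k < N) b k * c ^+ k.+1 = (f N).[c].
  by rewrite horner_sum; apply: eq_bigr => k _; rewrite hornerZ hornerXn.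
apply: (peak_support_le c01 cnu) => j; set q := peak c j.
have q0 t : unit_itv t -> 0 <= q.[t].
  by have /andP[? ?] := c01; apply: peak_ge0; rewrite !ltW.
have step m : L (f N * q) <= L (f (m + N)%N * q) + (s (m + N)%N - s N) * L q.
  elim: m => [|m IH]; first by rewrite subrr mul0r addr0.
  apply: (le_trans IH); rewrite addSn /f /s !big_ord_recr /= -/(f _) -/(s _).
  set k := (m + N)%N; rewrite [in leRHS]mulrDl poly_intD -scalerAl poly_intZ.
  have Xq0 : 0 <= L ('X^(k.+1) * q).
    rewrite -[0](mul0r (L 0)) -poly_intZ; apply: le_poly_int => t tu.
    rewrite scale0r horner0 hornerM hornerXn mulr_ge0 ?q0//.
    by have /andP[t0 _] := tu; rewrite exprn_ge0.
  have Xq1 : L ('X^(k.+1) * q) <= L q.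
    apply: le_poly_int => t tu; rewrite hornerM hornerXn ler_piMl ?q0//.
    by have /andP[t0 t1] := tu; rewrite exprn_ile1.
  have : - (b k * L ('X^(k.+1) * q)) <= `|b k| * L q.
    rewrite (le_trans (ler_norm _))// normrN normrM (ger0_norm Xq0).
    by rewrite ler_wpM2l.
  lra.
have lim : L (f (m + N)%N * q) + (s (m + N)%N - s N) * L q @[m --> \oo] -->
    0 + (S - s N) * L q.
  apply: cvgD.
    by have := poly_int_partial_cvg0 q; rewrite -(cvg_shiftn N).
  apply: cvgMr_tmp; apply: cvgB; last exact: cvg_cst.
  by move: bS; rewrite -(cvg_shiftn N).
rewrite -[leRHS]add0r -(cvg_lim _ lim)//; apply: limr_ge; last exact: nearW.
by apply/cvg_ex; eexists; exact: lim.
Qed.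

End moment_series.

(** The one-sided bound, applied to [b] and to [- b], traps [c] times the partial sum between two
    tails tending to [0]. *)
Lemma msupport_moment_root (R : realType)
    (nu : {finite_measure set R -> \bar R}) (b : nat -> R) (c M : R) :
  0 < c < 1 -> msupport nu c ->
  (forall N, \sum_(k < N) `|b k| <= M) ->
  (forall n, \sum_(k < N) b k * poly_int nu 'X^(n + k.+1) @[N --> \oo] --> 0) ->
  \sum_(k < N) b k * c ^+ k @[N --> \oo] --> 0.
Proof.
move=> c01 cnu bM bL; set s := fun N => \sum_(k < N) `|b k|.
have s_cvg : cvgn s.
  apply: nondecreasing_is_cvgn.
    by apply/nondecreasing_seqP => n; rewrite /s big_ord_recr lerDl.
  by exists M => _ [n _ <-]; exact: bM.
have ub := moment_partial_le bL c01 cnu s_cvg.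
have bNL n : \sum_(k < N) - b k * poly_int nu 'X^(n + k.+1) @[N --> \oo] --> 0.
  have -> : (fun N => \sum_(k < N) - b k * poly_int nu 'X^(n + k.+1)) =
      (fun N => - \sum_(k < N) b k * poly_int nu 'X^(n + k.+1)).
    apply/funext => N; rewrite -sumrN.
    by apply: eq_bigr => k _; rewrite mulNr.
  by have := cvgN (bL n); rewrite oppr0; exact.
have sN_cvg : \sum_(k < N) `|- b k| @[N --> \oo] --> limn s.
  have -> // : (fun N => \sum_(k < N) `|- b k|) = s.
  by apply/funext => N; apply: eq_bigr => k _; rewrite normrN.
have lb := @moment_partial_le _ _ (fun k => - b k) bNL _ _ c01 cnu sN_cvg.
have tail0 : c^-1 * (limn s - s N) @[N --> \oo] --> 0.
  have : limn s - s N @[N --> \oo] --> 0.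
    by rewrite -(subrr (limn s)); apply: cvgB => //; exact: cvg_cst.
  by move=> /(@cvgMl_tmp _ _ _ _ _ c^-1); rewrite mulr0; exact.
have /andP[c0 _] := c01.
apply/norm_cvg0P; apply: squeeze_cvgr (cvg_cst 0) tail0.
apply: nearW => N; rewrite normr_ge0 /=.
have cE : \sum_(k < N) b k * c ^+ k.+1 = c * \sum_(k < N) b k * c ^+ k.
  by rewrite mulr_sumr; apply: eq_bigr => k _; rewrite exprS mulrCA.
rewrite ler_pdivlMl// -{1}(gtr0_norm c0) -normrM -cE ler_norml ub andbT.
have := lb N; under eq_bigr do rewrite mulNr; rewrite sumrN.
under [X in _ - X]eq_bigr do rewrite normrN.
rewrite -/(s N); lra.
Qed.

(** * Supports, the integers and convolution squares *)

Lemma msupport_subset (R : realType) (mu : {measure set R -> \bar R})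
    (F : set R) :
  closed F -> (msupport mu `<=` F <-> mu (~` F) = 0%E).
Proof.
move=> cF; have mCF : measurable (~` F).
  by apply: measurableC; exact: closed_measurable.
split=> [suppF|muF0 x suppx]; last first.
  apply: contrapT => nFx; have : nbhs x (~` F).
    by apply: open_nbhs_nbhs; split=> //; exact: closed_openC.
  move=> /nbhs_ballP[e /= e0 eF]; have := suppx e e0.
  rewrite lt_neqAle eq_sym => /andP[/eqP + _]; apply.
  apply/eqP; rewrite -measure_le0 -muF0 le_measure ?inE//.
  exact: measurable_ball.
(* Second countability: the complement is covered by the null intervals with
   rational end points. *)
pose I (k : nat) : set R := if unpickle k is Some q
  then `]ratr (q : rat * rat).1, ratr q.2[%classic else set0.
pose J (k : nat) : set R := if mu (I k) == 0%E then I k else set0.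
have mI k : measurable (I k) by rewrite /I; case: unpickle => // -[].
have nJ k : mu.-negligible (J k).
  rewrite /J; case: ifPn => [/eqP muI0|_]; last exact: negligible_set0.
  exact/negligibleP.
apply/negligibleP => //; apply: negligibleS (negligible_bigcup nJ) => x nFx.
have : ~ msupport mu x by move=> /suppF.
move=> /existsNP[e /not_implyP[e0 /negP]]; rewrite -leNgt measure_le0 => /eqP mu0.
have [p] := @rat_in_itvoo R (x - e) x ltac:(by rewrite ltrBlDr ltrDl).
have [q] := @rat_in_itvoo R x (x + e) ltac:(by rewrite ltrDl).
rewrite !in_itv /= => /andP[xq qe] /andP[ep px].
have IE : I (pickle (p, q)) = `]ratr p, ratr q[%classic by rewrite /I pickleK.
exists (pickle (p, q)) => //; rewrite /J.
suff -> : mu (I (pickle (p, q))) == 0%E by rewrite IE /= in_itv /= px xq.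
rewrite -measure_le0 -[leRHS]mu0; apply: le_measure.
- by rewrite inE; exact: mI.
- by rewrite inE; exact: measurable_ball.
rewrite IE => y /=; rewrite in_itv /= => /andP[py yq].
by rewrite /ball /= ltr_distlC (lt_trans ep py) (lt_trans yq qe).
Qed.

Lemma closed_Zset (R : realType) : closed (@Zset R).
Proof.
rewrite -[Zset]setCK closedC openE => x nZx.
have flx : (Num.floor x)%:~R < x.
  rewrite lt_neqAle floor_le andbT; apply/eqP => xE.
  by apply: nZx; exists (Num.floor x).
have xfl := floorD1_gt x.
apply/nbhs_ballP.
exists (Num.min (x - (Num.floor x)%:~R) ((Num.floor x + 1)%:~R - x)).
  by rewrite /= lt_min !subr_gt0 flx xfl.
move=> y; rewrite /ball /= lt_min => /andP[].
rewrite !ltr_distlC => /andP[fly _] /andP[_ yfl] [z yz].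
have : (Num.floor x < z)%R by rewrite -(ltr_int R) -yz; lra.
have : (z < Num.floor x + 1)%R by rewrite -(ltr_int R) -yz; lra.
lia.
Qed.

Lemma measurable_Zset (R : realType) : measurable (@Zset R).
Proof. by apply: closed_measurable; exact: closed_Zset. Qed.

Lemma shiftset1 (R : realType) (a y : R) : shiftset [set a] y = [set a - y].
Proof.
apply/seteqP; split=> x; rewrite /shiftset /=.
  by move=> <-; rewrite addrK.
by move=> ->; rewrite subrK.
Qed.

Lemma measurable_nonneg_half (R : realType) : measurable (@nonneg_half R).
Proof.
rewrite (_ : nonneg_half = `[0, +oo[%classic); first exact: measurable_itv.
by apply/seteqP; split=> x; rewrite /= in_itv /= andbT.
Qed.

Lemma measurable_shiftset (R : realType) (A : set R) (y : R) :
  measurable A -> measurable (shiftset A y).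
Proof.
move=> mA; rewrite -[shiftset A y]setTI.
apply: (_ : measurable_fun setT (fun x : R => x + y)) => //.
exact: measurable_funD.
Qed.

Lemma convpow1 (R : realType) (mu : probability R R) (A : set R) :
  measurable A -> convpow mu 1 A = mu A.
Proof.
move=> mA; rewrite /=.
rewrite (eq_integral (fun y => (\1_A y)%:E)); last first.
  move=> y _; rewrite diracE indicE; congr (_%:R%:E).
  by congr nat_of_bool; apply/idP/idP; rewrite !inE /shiftset /= add0r.
by rewrite integral_indic// setIT.
Qed.

Lemma convpow2 (R : realType) (mu : probability R R) (A : set R) :
  measurable A -> convpow mu 2 A = (\int[mu]_y mu (shiftset A y))%E.
Proof.
move=> mA; apply: eq_integral => y _; apply: convpow1.
exact: measurable_shiftset.
Qed.

(** The shifts of [A] are the sections of its preimage under addition. *)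
Lemma measurable_fun_shiftset (R : realType) (mu : probability R R)
    (A : set R) :
  measurable A -> measurable_fun setT (fun y => mu (shiftset A y)).
Proof.
move=> mA; pose B : set (R * R) := [set z | A (z.2 + z.1)].
have mB : measurable B.
  rewrite -[B]setTI.
  apply: (_ : measurable_fun setT (fun z : R * R => z.2 + z.1)) => //.
  by apply: measurable_funD; [exact: measurable_snd|exact: measurable_fst].
have := measurable_fun_xsection mu mB.
congr (measurable_fun _ _); apply/funext => y /=; congr (mu _).
by apply/seteqP; split=> x; rewrite /xsection /= inE.
Qed.
Lemma integral_singleton (R : realType) (mu : {measure set R -> \bar R})
    (f : R -> \bar R) (a : R) :
  (\int[mu]_(y in [set a]) f y = f a * mu [set a])%E.
Proof.
rewrite (eq_integral (cst (f a))); first by rewrite integral_cst.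
by move=> y; rewrite inE => ->.
Qed.

Lemma convpow2_Zset (R : realType) (mu : probability R R) (A : set R) :
  mu (~` Zset) = 0%E -> measurable A ->
  convpow mu 2 A = (\int[mu]_(y in Zset) mu (shiftset A y))%E.
Proof.
move=> muZ mA; rewrite convpow2//.
rewrite (ge0_negligible_integral _ _ _ _ muZ)//.
- by rewrite setTD setCK.
- by apply: measurableC; exact: measurable_Zset.
- exact: measurable_fun_shiftset.
Qed.

Lemma convpow2_le1 (R : realType) (mu : probability R R) (A : set R) :
  measurable A -> (convpow mu 2 A <= 1)%E.
Proof.
move=> mA; rewrite convpow2//.
apply: (@le_trans _ _ (\int[mu]_y (cst 1 y))%E); last first.
  by rewrite integral_cst// mul1e; exact: probability_le1.
apply: ge0_le_integral => //.
- exact: measurable_fun_shiftset.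
- by move=> y _; apply: probability_le1; exact: measurable_shiftset.
Qed.

Lemma Zset_addn (R : realType) (x : R) (n : nat) : Zset (x + n%:R) <-> Zset x.
Proof.
split=> -[z xE].
  by exists (z - n%:Z); rewrite intrB -xE addrK.
by exists (z + n%:Z); rewrite intrD -xE.
Qed.

(** The square of [mu] gives no mass to the nonnegative non-integers [A], hence neither does that of
    [mu1]. Each atom of [mu1] at [n] then forces [A - n] to be null for [mu1], and these shifts
    cover the complement of [Zset]. *)
Lemma Zset_transfer (R : realType) (mu mu1 : probability R R) :
  (forall n : nat, (0 < mu1 [set n%:R])%E) ->
  eq_on_nonneg (convpow mu1 2) (convpow mu 2) ->
  mu (~` Zset) = 0%E -> mu1 (~` Zset) = 0%E.
Proof.
move=> mu1_gt0 conv_eq muZ.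
have mCZ : measurable (~` @Zset R) by apply: measurableC; exact: measurable_Zset.
pose A : set R := nonneg_half `&` ~` Zset.
have mA : measurable A.
  by apply: measurableI => //; exact: measurable_nonneg_half.
have conv0 : convpow mu 2 A = 0%E.
  rewrite convpow2_Zset//; apply: integral0_eq => y [z yz].
  apply/eqP; rewrite -measure_le0 -[leRHS]muZ; apply: le_measure.
  - by rewrite inE; exact: measurable_shiftset.
  - by rewrite inE.
  - by move=> x [_ nZ] [z' xz]; apply: nZ; exists (z' + z); rewrite intrD -xz -yz.
have mu1A n : mu1 (shiftset A n%:R) = 0%E.
  have : convpow mu1 2 A = 0%E by rewrite conv_eq//; move=> x [].
  rewrite convpow2// => int0.
  have : (\int[mu1]_(y in [set n%:R]) mu1 (shiftset A y) <= 0)%E.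
    rewrite -[leRHS]int0; apply: ge0_subset_integral => //.
    exact: measurable_fun_shiftset.
  rewrite integral_singleton => le0.
  apply/eqP; rewrite eq_le measure_ge0 andbT leNgt; apply/negP => gt0.
  by move: le0; rewrite leNgt => /negP; apply; exact: (mule_gt0 gt0 (mu1_gt0 n)).
apply/negligibleP => //.
have nA n : mu1.-negligible (shiftset A n%:R).
  by apply/negligibleP; [exact: measurable_shiftset|exact: mu1A].
apply: negligibleS (negligible_bigcup nA) => x nZx.
(* This shift exceeds [|x|], so it moves [x] into the nonnegative half-line. *)
exists (Num.truncn `|x|).+1 => //; split.
  have := truncnS_gt `|x|; have := ler_norm (- x); rewrite normrN /nonneg_half /=.
  lra.
by move=> /Zset_addn.
Qed.

(** * The convolution square at a nonnegative integer as a series *)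

(* [kdist n z] is the distance from the integer [z] to [{0, ..., n}]: its fibre
   over [k.+1] consists of [- k.+1] and [n + k.+1], which pairs the two equal
   cross terms of the convolution square at [n]. *)
Definition kdist (n : nat) (z : int) : nat :=
  match z with Posz m => (m - n)%N | Negz m => m.+1 end.

Definition kfibre {R : realType} (n k : nat) : set R :=
  [set x | exists2 z : int, x = z%:~R & kdist n z = k].

Lemma kfibre0 (R : realType) (n : nat) :
  @kfibre R n 0 = \big[setU/set0]_(i <- iota 0 n.+1) [set i%:R].
Proof.
rewrite -bigcup_seq; apply/seteqP; split=> x.
  move=> [[m|m] -> //= /eqP]; rewrite subn_eq0 => mn.
  have mi : m \in iota 0 n.+1 by rewrite mem_iota.
  by exists m.
move=> [m mi ->]; have : m \in iota 0 n.+1 by [].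
rewrite mem_iota /= ltnS => mn; exists m%:Z => //=.
by apply/eqP; rewrite subn_eq0.
Qed.

Lemma kfibreS (R : realType) (n k : nat) :
  @kfibre R n k.+1 = [set - k.+1%:R] `|` [set (n + k.+1)%:R].
Proof.
apply/seteqP; split=> x.
  move=> [[m|m] -> /=]; last by case=> ->; left; rewrite NegzE mulrNz.
  by move=> mnk; right; rewrite (_ : m = (n + k.+1)%N)//; lia.
move=> [|] ->; first by exists (Negz k) => //; rewrite NegzE mulrNz.
by exists (n + k.+1)%N%:Z => //=; lia.
Qed.

Lemma measurable_kfibre (R : realType) (n k : nat) : measurable (@kfibre R n k).
Proof.
case: k => [|k]; last by rewrite kfibreS; exact: measurableU.
by rewrite kfibre0; apply: bigsetU_measurable.
Qed.

Lemma trivIset_kfibre (R : realType) (n : nat) : trivIset setT (@kfibre R n).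
Proof.
apply/trivIsetP => i j _ _ /eqP ij; apply/seteqP; split=> // x.
move=> [[z -> zi] [z' /eqP]]; rewrite eqr_int => /eqP <- zj.
by apply: ij; rewrite -zi.
Qed.

Lemma bigcup_kfibre (R : realType) (n : nat) : \bigcup_k @kfibre R n k = Zset.
Proof.
apply/seteqP; split=> x; first by move=> [k _ [z ->]]; exists z.
by move=> [z ->]; exists (kdist n z) => //; exists z.
Qed.

Lemma convpow2_series (R : realType) (mu : probability R R) (n : nat) :
  mu (~` Zset) = 0%E ->
  convpow mu 2 [set n%:R] =
  (\sum_(k <oo) \int[mu]_(y in kfibre n k) mu [set (n%:R - y)%R])%E.
Proof.
move=> muZ; rewrite convpow2_Zset//.
rewrite -(bigcup_kfibre R n) ge0_integral_bigcup//.
- by apply: eq_eseriesr => k _; apply: eq_integral => y _; rewrite shiftset1.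
- by move=> k; exact: measurable_kfibre.
- by apply: measurable_funTS; exact: measurable_fun_shiftset.
- exact: trivIset_kfibre.
Qed.
Definition atom {R : realType} (mu : probability R R) (x : R) : R :=
  fine (mu [set x]).

Lemma EFin_atom (R : realType) (mu : probability R R) (x : R) :
  (atom mu x)%:E = mu [set x].
Proof. by rewrite fineK// fin_num_measure. Qed.

Lemma atom_ge0 (R : realType) (mu : probability R R) (x : R) : 0 <= atom mu x.
Proof. exact: fine_ge0. Qed.

Lemma measurable_fun_reflected_atom (R : realType) (mu : probability R R)
    (a : R) (D : set R) :
  measurable_fun D (fun y => mu [set a - y]).
Proof.
apply: measurable_funTS.
have := @measurable_fun_shiftset R mu [set a] (measurable_set1 _).
by congr (measurable_fun _ _); apply/funext => y; rewrite shiftset1.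
Qed.

Lemma integral_kfibre0 (R : realType) (mu : probability R R) (n : nat) :
  (\int[mu]_(y in kfibre n 0) mu [set (n%:R - y)%R])%E =
  (\sum_(i <- iota 0 n.+1) atom mu (n%:R - i%:R) * atom mu i%:R)%:E.
Proof.
rewrite kfibre0 ge0_integral_bigsetU//.
- rewrite -sumEFin; apply: eq_bigr => i _.
  by rewrite integral_singleton EFinM !EFin_atom.
- exact: iota_uniq.
- apply/trivIsetP => i j _ _ /eqP ij; apply/seteqP; split=> // x [-> /eqP].
  by rewrite eqr_nat => /eqP.
- exact: measurable_fun_reflected_atom.
Qed.

Lemma integral_kfibreS (R : realType) (mu : probability R R) (n k : nat) :
  (\int[mu]_(y in kfibre n k.+1) mu [set (n%:R - y)%R])%E =
  (2 * (atom mu (- k.+1%:R) * atom mu (n + k.+1)%:R))%:E.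
Proof.
rewrite kfibreS ge0_integral_setU//.
- rewrite !integral_singleton mulr_natl mulr2n EFinD EFinM !EFin_atom.
  have -> : n%:R - - k.+1%:R = (n + k.+1)%:R :> R by rewrite opprK natrD.
  have -> : n%:R - (n + k.+1)%:R = - k.+1%:R :> R.
    by rewrite natrD opprD addrA subrr add0r.
  by congr (_ + _)%E; rewrite muleC.
- exact: measurable_fun_reflected_atom.
- apply/disj_setPS => x [-> /eqP].
  by rewrite eq_sym -subr_eq0 opprK -natrD pnatr_eq0 addnS.
Qed.

(** The finite sum involves only atoms at nonnegative integers; the series pairs each negative atom
    with one at a positive integer. The square has mass at most [1], so the limit may be taken in
    the reals. *)
Lemma convpow2_cvg (R : realType) (mu : probability R R) (n : nat) :
  mu (~` Zset) = 0%E ->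
  \sum_(i <- iota 0 n.+1) atom mu (n%:R - i%:R) * atom mu i%:R +
  \sum_(k < N) 2 * (atom mu (- k.+1%:R) * atom mu (n + k.+1)%:R)
  @[N --> \oo] --> fine (convpow mu 2 [set n%:R]).
Proof.
move=> muZ; set S := \sum_(i <- _) _.
(* Index [0] holds the fibre over [0]; the shift by one at the end of the proof separates it from
   the cross terms. *)
pose v k := if k is k'.+1
  then 2 * (atom mu (- k'.+1%:R) * atom mu (n + k'.+1)%:R) else S.
have vE k : (\int[mu]_(y in kfibre n k) mu [set (n%:R - y)%R])%E = (v k)%:E.
  by case: k => [|k]; [exact: integral_kfibre0|exact: integral_kfibreS].
have convE : convpow mu 2 [set n%:R] = (\sum_(k <oo) (v k)%:E)%E.
  by rewrite convpow2_series//; apply: eq_eseriesr => k _; exact: vE.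
have v_cvg : cvgn (fun N => \sum_(0 <= k < N) (v k)%:E)%E.
  apply: is_cvg_nneseries => k _ _; rewrite -vE.
  by apply: integral_ge0 => y _.
have : (\sum_(0 <= k < N) v k)%:E @[N --> \oo] -->
    (fine (convpow mu 2 [set n%:R]))%:E.
  rewrite fineK; last first.
    rewrite ge0_fin_numE; last by rewrite convpow2//; exact: integral_ge0.
    by rewrite (le_lt_trans (convpow2_le1 mu _))// ltry.
  rewrite convE; have -> : (fun N => (\sum_(0 <= k < N) v k)%:E) =
      (fun N => \sum_(0 <= k < N) (v k)%:E)%E.
    by apply/funext => N; rewrite sumEFin.
  exact: v_cvg.
move=> /fine_cvg; rewrite -(cvg_shiftn 1) /=.
have -> // : (fun N => fine (\sum_(0 <= k < N + 1) v k)%:E) = (fun N => S +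
    \sum_(k < N) 2 * (atom mu (- k.+1%:R) * atom mu (n + k.+1)%:R)).
by apply/funext => N /=; rewrite addn1 big_nat_recl// big_mkord.
Qed.

(** * Comparison of the two measures *)

Lemma sum_neg_atom_le1 (R : realType) (mu : probability R R) (N : nat) :
  \sum_(k < N) atom mu (- k.+1%:R) <= 1.
Proof.
rewrite -lee_fin -sumEFin; under eq_bigr do rewrite EFin_atom.
rewrite -(@measure_bigsetU_ord _ _ _ mu N xpredT (fun k => [set - k.+1%:R]))//.
  by apply: probability_le1; exact: bigsetU_measurable.
apply/trivIsetP => i j _ _ /eqP ij; apply/seteqP; split=> // x [-> /eqP].
by rewrite eqr_opp eqr_nat eqSS => /eqP/val_inj.
Qed.

Lemma poly_int_Xn_gt0 (R : realType) (nu : {finite_measure set R -> \bar R})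
    (c : R) (n : nat) :
  0 < c < 1 -> msupport nu c -> 0 < poly_int nu 'X^n.
Proof.
(* With this radius the left end of the ball is [c - r = c^2 > 0], and the right end is
   [1 - (1 - c)^2 < 1]. *)
move=> /andP[c0 c1] cnu; pose r := c * (1 - c).
have r0 : 0 < r by rewrite mulr_gt0// subr_gt0.
have Br t : ball c r t -> c ^+ 2 <= t <= 1.
  by rewrite /ball /= ltr_distlC /r => /andP[? ?]; apply/andP; split; nra.
have Bu : ball c r `<=` unit_itv.
  move=> t /Br/andP[ct t1]; apply/andP; split=> //.
  by rewrite (le_trans _ ct)// sqr_ge0.
apply: (@lt_le_trans _ _
  ((c ^+ 2) ^+ n * fine (nu (ball c r)) - 0 * fine (nu unit_itv))).
  rewrite mul0r subr0 mulr_gt0// ?exprn_gt0// fine_gt0// cnu//=.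
  by rewrite ltey_eq fin_num_measure//; exact: measurable_ball.
apply: poly_int_ball_ge => // t /andP[t0 t1].
rewrite subr0 hornerXn indicE; case: (boolP (t \in _)) => [|_] /=; last first.
  by rewrite mulr0 exprn_ge0.
by rewrite inE mulr1 => /Br/andP[ct _]; rewrite lerXn2r ?nnegrE ?sqr_ge0.
Qed.

Lemma neg_atom_eq (R : realType) (mu mu1 : probability R R)
    (nu : {finite_measure set R -> \bar R}) (c : nat -> R) :
  (forall n, 0 < c n < 1) -> (forall n, c n.+1 < c n) ->
  (forall n, msupport nu (c n)) ->
  (forall n : nat, atom mu n%:R = poly_int nu 'X^n) ->
  mu (~` Zset) = 0%E -> mu1 (~` Zset) = 0%E ->
  eq_on_nonneg mu1 mu -> eq_on_nonneg (convpow mu1 2) (convpow mu 2) ->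
  forall k : nat, mu1 [set - k.+1%:R] = mu [set - k.+1%:R].
Proof.
move=> c01 cdec cnu muE muZ mu1Z eq1 eq2 k.
(* Indices are shifted by one: [b k] belongs to the point [- (k + 1)], so it meets the moment of
   order [n + k + 1]. *)
pose b k := atom mu (- k.+1%:R) - atom mu1 (- k.+1%:R).
suff : b k = 0 by move=> /eqP; rewrite subr_eq0 -!EFin_atom => /eqP ->.
have atomE (n : nat) : atom mu1 n%:R = atom mu n%:R.
  by rewrite /atom eq1// => x ->; rewrite /nonneg_half /=.
have bM N : \sum_(i < N) `|b i| <= 2.
  apply: (@le_trans _ _ (\sum_(i < N)
      (atom mu (- i.+1%:R) + atom mu1 (- i.+1%:R)))).
    apply: ler_sum => i _; rewrite (le_trans (ler_normB _ _))//.
    by rewrite !ger0_norm ?atom_ge0.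
  by rewrite big_split /= -[leRHS]/(1 + 1) lerD ?sum_neg_atom_le1.
apply: (pseries_zeros_coef c01 cdec bM) => i.
apply: (msupport_moment_root (c01 i) (cnu i) bM) => n.
pose X (m : probability R R) N :=
  \sum_(j <- iota 0 n.+1) atom m (n%:R - j%:R) * atom m j%:R +
  \sum_(j < N) 2 * (atom m (- j.+1%:R) * atom m (n + j.+1)%:R).
have lim : X mu N - X mu1 N @[N --> \oo] --> 0.
  rewrite -(subrr (fine (convpow mu 2 [set n%:R]))).
  apply: cvgB; first exact: convpow2_cvg.
  rewrite -(eq2 [set n%:R])//; first exact: convpow2_cvg.
  by move=> x ->; rewrite /nonneg_half /=.
have -> : (fun N => \sum_(j < N) b j * poly_int nu 'X^(n + j.+1)) =
    (fun N => 2^-1 * (X mu N - X mu1 N)).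
  apply/funext => N; rewrite /X.
  (* For [j <= n] both [j] and [n - j] are nonnegative, where the atoms agree; the finite sums
     therefore cancel. *)
  have -> : \sum_(j <- iota 0 n.+1) atom mu1 (n%:R - j%:R) * atom mu1 j%:R =
      \sum_(j <- iota 0 n.+1) atom mu (n%:R - j%:R) * atom mu j%:R.
    apply: eq_big_seq => j; rewrite mem_iota /= ltnS => jn.
    by rewrite -natrB// !atomE.
  rewrite opprD addrACA subrr add0r -sumrB mulr_sumr.
  by apply: eq_bigr => j _; rewrite /b -muE atomE; field.
by have := @cvgMl_tmp _ _ _ _ _ 2^-1 _ lim; rewrite mulr0; exact.
Qed.

Lemma Zset_measure_eq (R : realType) (mu mu1 : probability R R) :
  mu (~` Zset) = 0%E -> mu1 (~` Zset) = 0%E -> eq_on_nonneg mu1 mu ->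
  (forall k : nat, mu1 [set - k.+1%:R] = mu [set - k.+1%:R]) ->
  forall A, measurable A -> mu1 A = mu A.
Proof.
move=> muZ mu1Z eqn eqz A mA.
have mn := @measurable_nonneg_half R.
have mZ := @measurable_Zset R; have mCZ := measurableC mZ.
pose F k : set R := A `&` [set - k.+1%:R].
have mF k : measurable (F k) by exact: measurableI.
have tF : trivIset setT F.
  apply/trivIsetP => i j _ _ /eqP ij; apply/seteqP; split=> // x [[_ ->] [_ /eqP]].
  by rewrite eqr_opp eqr_nat eqSS => /eqP.
(* Up to a null set, the negative part of [A] is a countable disjoint union of the points
   [- (k + 1)] lying in [A]. *)
have split (m : probability R R) : m (~` Zset) = 0%E ->
    (m A = m (A `&` nonneg_half) + \sum_(k <oo) m (F k))%E.
  move=> m0; rewrite -measure_semi_bigcup//; last exact: bigcup_measurable.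
  have mAn : measurable (A `\` nonneg_half) by exact: measurableD.
  rewrite (measureDI m mA mn) addeC; congr (_ + _)%E.
  have D0 : m (A `\` nonneg_half `\` Zset) = 0%E.
    by apply: subset_measure0 m0 => //; first exact: measurableD.
  rewrite (measureDI m mAn mZ) -[RHS]add0e; congr (_ + _)%E; first exact: D0.
  congr (m _); apply/seteqP; split=> x.
    move=> [[Ax nx] [[z|z] xz]]; first by case: nx; rewrite xz /nonneg_half /=.
    by exists z => //; split=> //=; rewrite xz NegzE mulrNz.
  move=> [k _ [Ax /= xk]]; split; last by exists (Negz k); rewrite NegzE mulrNz.
  by split=> //; rewrite xk /nonneg_half /= oppr_ge0 lern0.
rewrite (split mu)// (split mu1)//; congr (_ + _)%E.
  by apply: eqn; [exact: measurableI|move=> x []].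
apply: eq_eseriesr => k _.
have [Ak|nAk] := pselect (A (- k.+1%:R)).
  have -> // : F k = [set - k.+1%:R].
  by apply/seteqP; split=> [x []//|x ->].
have -> : F k = set0 by apply/seteqP; split=> // x [/[swap] ->].
by rewrite !measure0.
Qed.
Unset Implicit Arguments.

Theorem theorem3p12 (R : realType) (mu : probability R R)
  (Hsupp : ~ (msupport mu `<=` [set x | x < 0]))
  (HCM : completely_monotone (fun n : nat => fine (mu [set n%:R])))
  (Hnu : exists nu : {finite_measure set R -> \bar R},
     nu (~` unit_itv) = 0%E /\
     (forall n : nat, mu [set n%:R] = (\int[nu]_(t in unit_itv) (t ^+ n)%:E)%E) /\
     exists c : nat -> R,
       (forall n, 0 < c n < 1) /\
       (forall n, c n.+1 < c n) /\
       (forall n, msupport nu (c n)) /\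
       ((\sum_(0 <= k < n) (- ln (c k))^-1) @[n --> \oo] --> +oo)) :
  (forall mu1 : probability R R,
     ~ (msupport mu1 `<=` [set x | x < 0]) ->
     eq_on_nonneg mu1 mu ->
     eq_on_nonneg (convpow mu1 2) (convpow mu 2) ->
     (msupport mu `<=` Zset <-> msupport mu1 `<=` Zset)) /\
  (msupport mu `<=` Zset ->
     (forall mu1 : probability R R,
        eq_on_nonneg mu1 mu ->
        eq_on_nonneg (convpow mu1 2) (convpow mu 2) ->
        forall A : set R, measurable A -> mu1 A = mu A) /\
     inC mu).
Proof.
case: Hnu => nu [_ [momE [c [c01 [cdec [cnu _]]]]]].
have muE n : atom mu n%:R = poly_int nu 'X^n.
  rewrite /atom momE /poly_int; congr fine.
  by apply: eq_integral => t _; rewrite hornerXn.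
have mu_gt0 n : (0 < mu [set n%:R])%E.
  by rewrite -EFin_atom lte_fin muE (poly_int_Xn_gt0 n (c01 0) (cnu 0)).
have suppZ (m : probability R R) : msupport m `<=` Zset <-> m (~` Zset) = 0%E.
  by apply: msupport_subset; exact: closed_Zset.
have mu1_gt0 (mu1 : probability R R) : eq_on_nonneg mu1 mu ->
    forall n : nat, (0 < mu1 [set n%:R])%E.
  by move=> eq1 n; rewrite eq1// => x ->; rewrite /nonneg_half /=.
have determined : msupport mu `<=` Zset -> forall mu1 : probability R R,
    eq_on_nonneg mu1 mu -> eq_on_nonneg (convpow mu1 2) (convpow mu 2) ->
    forall A, measurable A -> mu1 A = mu A.
  move=> /suppZ muZ mu1 eq1 eq2.
  have mu1Z := Zset_transfer (mu1_gt0 _ eq1) eq2 muZ.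
  exact: Zset_measure_eq (neg_atom_eq c01 cdec cnu muE muZ mu1Z eq1 eq2).
split=> [mu1 _ eq1 eq2|muZ].
  split=> /suppZ mZ; apply/suppZ.
    exact: Zset_transfer (mu1_gt0 _ eq1) eq2 mZ.
  (* The converse exchanges [mu] and [mu1]; now the positive atoms of [mu] are used. *)
  by apply: Zset_transfer mu_gt0 _ mZ => A mA An; rewrite eq2.
split; first exact: determined.
(* Only the powers [n = 1] and [n = 2] are taken from the hypothesis of [inC]. *)
move=> mu1 eqn; apply: determined => //; last exact: eqn.
by move=> A mA An; rewrite -!convpow1// eqn.
Qed.
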